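(* Let $\mathcal{M}\in\{\mathcal{P}_n,\mathcal{B}_n,\mathcal{S}_n\}$ be endowed with its Fisher–Rao metric $g$ (given in the context), and let $f$ be a continuously differentiable objective function (such as $f(x)=\mathrm{KL}(Ax,b)$ with $A\in\mathbb{R}^{m\times n}_+$, $b\in\mathbb{R}^m_{++}$). Then the SMART iteration with parameters $\tau_k>0$ and $x_0\in\mathcal{M}$, $$x_{k+1}=\frac{1}{Z(x_k)}\cdot x_k\cdot e^{-\tau_k\partial f(x_k)},\qquad Z(x_k)=\begin{cases}1,&\mathcal{M}=\mathcal{P}_n,\\ \mathbf{1}-x_k+x_k\cdot e^{-\tau_k\partial f(x_k)},&\mathcal{M}=\mathcal{B}_n,\\ \langle x_k,e^{-\tau_k\partial f(x_k)}\rangle,&\mathcal{M}=\mathcal{S}_n,\end{cases}$$ equals the Riemannian gradient descent iteration $$x_{k+1}=\operatorname{Exp}_{x_k}\big(-\tau_k\operatorname{grad} f(x_k)\big)=\exp_{x_k}\big(-\tau_k\partial f(x_k)\big).$$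
   Context: Notation: $\mathbf{1}$ is the all-ones vector; $\log$, $e^{(\cdot)}$, products $x\cdot z$ and quotients $\frac{z}{x}$ of vectors are componentwise; $\langle\cdot,\cdot\rangle$ is the Euclidean inner product; $\partial f$ is the Euclidean gradient. $\mathrm{KL}(y,y')=\langle y,\log y-\log y'\rangle-\langle\mathbf{1},y-y'\rangle$ with $0\log0=0$. Manifolds: $\mathcal{P}_n=\mathbb{R}^n_{++}$, $\mathcal{B}_n=(0,1)^n$, $\mathcal{S}_n=\{p\in\mathbb{R}^n: p_i>0\ \forall i,\ \langle\mathbf{1},p\rangle=1\}$, with tangent spaces $\mathbb{R}^n$, $\mathbb{R}^n$ and $T_0=\{v\in\mathbb{R}^n:\langle\mathbf{1},v\rangle=0\}$. The function $f$ is continuously differentiable on an open subset of $\mathbb{R}^n$ containing $\mathcal{M}$. Fisher–Rao metric $\langle u,v\rangle_x=\langle u,G(x)v\rangle$ with $G(x)=\operatorname{Diag}(\mathbf{1}/x)$ for $\mathcal{P}_n$ and $\mathcal{S}_n$ (on $T_0$ for the latter), and $G(x)=\operatorname{Diag}\big(\mathbf{1}/(x\cdot(\mathbf{1}-x))\big)$ for $\mathcal{B}_n$. $\operatorname{grad}f(x)$ is the Riemannian gradient, i.e. the tangent vector with $\langle\operatorname{grad}f(x),v\rangle_x=df(x)v$ for all tangent $v$. For tangent $v$ at $x$: $\mathcal{P}_n$: $\operatorname{Exp}_x(v)=x\cdot e^{v/x}$; $\mathcal{B}_n$: $\operatorname{Exp}_x(v)=\dfrac{x\cdot e^{v/(x\cdot(\mathbf{1}-x))}}{\mathbf{1}-x+x\cdot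 e^{v/(x\cdot(\mathbf{1}-x))}}$; $\mathcal{S}_n$: $\operatorname{Exp}_x(v)=\dfrac{x\cdot e^{v/x}}{\langle x,e^{v/x}\rangle}$. For $w\in\mathbb{R}^n$: $\exp_x(w)=\operatorname{Exp}_x(G(x)^{-1}w)$ for $\mathcal{P}_n,\mathcal{B}_n$, and $\exp_x(w)=\operatorname{Exp}_x(\Pi_xw)$ with $\Pi_x=\operatorname{Diag}(x)-xx^\top$ for $\mathcal{S}_n$. *)

(* Defs.v *)
From HB Require Import structures.
From mathcomp Require Import all_boot all_order all_algebra.
From mathcomp Require Import all_classical all_reals all_analysis.
Import Order.TTheory GRing.Theory Num.Theory.
Import numFieldNormedType.Exports.

Set Implicit Arguments.
Unset Strict Implicit.
Unset Printing Implicit Defensive.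

Local Open Scope classical_set_scope.
Local Open Scope ring_scope.

(* R^n is the type 'cV[R]_n of column vectors. *)

Definition vmul (R : realType) (n : nat) (x y : 'cV[R]_n) : 'cV[R]_n :=
  \col_i (x i 0 * y i 0).
Definition vdiv (R : realType) (n : nat) (x y : 'cV[R]_n) : 'cV[R]_n :=
  \col_i (x i 0 / y i 0).
Definition vexp (R : realType) (n : nat) (x : 'cV[R]_n) : 'cV[R]_n :=
  map_mx expR x.
Definition vln (R : realType) (n : nat) (x : 'cV[R]_n) : 'cV[R]_n :=
  map_mx (@ln R) x.
Definition ones (R : realType) (n : nat) : 'cV[R]_n := const_mx 1.
Arguments ones {R n}.
Definition inner (R : realType) (n : nat) (x y : 'cV[R]_n) : R :=
  \sum_i x i 0 * y i 0.
Definition Diag (R : realType) (n : nat) (x : 'cV[R]_n) : 'M[R]_n :=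
  diag_mx x^T.

Notation "x ⊙ y" := (vmul x y) (at level 40, left associativity) : ring_scope.
Notation "x ⊘ y" := (vdiv x y) (at level 40, left associativity) : ring_scope.
Notation "⟨ x , y ⟩" := (inner x y) (at level 0, format "⟨ x ,  y ⟩")
  : ring_scope.

(* ln x = 0 for x <= 0, so 0 * ln 0 = 0. *)
Definition KL (R : realType) (n : nat) (y y' : 'cV[R]_n) : R :=
  ⟨y, vln y - vln y'⟩ - ⟨ones, y - y'⟩.

Definition egrad (R : realType) (n : nat) (f : 'cV[R]_n -> R) (x : 'cV[R]_n) :
    'cV[R]_n :=
  \col_i 'D_(delta_mx i 0 : 'cV[R]_n) f x.

(* f is a total function; its values outside U are irrelevant. *)
Definition C1_around (R : realType) (n : nat) (D : set 'cV[R]_n)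
    (f : 'cV[R]_n -> R) : Prop :=
  exists U : set 'cV[R]_n, [/\ open U, D `<=` U,
    forall x, U x -> differentiable f x &
    forall x, U x -> {for x, continuous (egrad f)}].

Inductive geometry := Orthant | Box | Simplex.

Section FisherRao.
Variables (R : realType) (n : nat) (M : geometry).
Implicit Types (x u v w : 'cV[R]_n) (f : 'cV[R]_n -> R) (t : R).

Definition carrier : set 'cV[R]_n :=
  match M with
  | Orthant => [set x : 'cV[R]_n | forall i, 0 < x i 0]
  | Box => [set x : 'cV[R]_n | forall i, 0 < x i 0 < 1]
  | Simplex =>
      [set x : 'cV[R]_n | (forall i, 0 < x i 0) /\ ⟨ones, x⟩ = 1]
  end.

Definition tangent : set 'cV[R]_n :=
  match M with
  | Orthant | Box => setT
  | Simplex => [set v : 'cV[R]_n | ⟨ones, v⟩ = 0]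
  end.

Definition G x : 'M[R]_n :=
  match M with
  | Orthant | Simplex => Diag (ones ⊘ x)
  | Box => Diag (ones ⊘ (x ⊙ (ones - x)))
  end.

Definition metric x u v : R := ⟨u, G x *m v⟩.

Definition is_rgrad f x u : Prop :=
  tangent u /\ forall v, tangent v -> metric x u v = 'd f x v.

(* The default value 0 is used only if no Riemannian gradient exists. *)
Definition rgrad f x : 'cV[R]_n := xget 0 [set u | is_rgrad f x u].

Definition Exp x v : 'cV[R]_n :=
  match M with
  | Orthant => x ⊙ vexp (v ⊘ x)
  | Box => let y := x ⊙ vexp (v ⊘ (x ⊙ (ones - x))) in
           y ⊘ (ones - x + y)
  | Simplex => ⟨x, vexp (v ⊘ x)⟩^-1 *: (x ⊙ vexp (v ⊘ x))
  end.

Definition exp_map x w : 'cV[R]_n :=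
  match M with
  | Orthant | Box => Exp x (invmx (G x) *m w)
  | Simplex => Exp x ((Diag x - x *m x^T) *m w)
  end.

(* The scalar values of Z are repeated in every component. *)
Definition Z f t x : 'cV[R]_n :=
  let y := vexp (- t *: egrad f x) in
  match M with
  | Orthant => ones
  | Box => ones - x + x ⊙ y
  | Simplex => const_mx ⟨x, y⟩
  end.

Definition smart_step f t x : 'cV[R]_n :=
  (ones ⊘ Z f t x) ⊙ x ⊙ vexp (- t *: egrad f x).

Definition rgd_step f t x : 'cV[R]_n := Exp x (- t *: rgrad f x).

Definition exp_step f t x : 'cV[R]_n := exp_map x (- t *: egrad f x).

End FisherRao.

Fixpoint iterates (R : realType) (n : nat)
    (step : R -> 'cV[R]_n -> 'cV[R]_n) (tau : nat -> R) (x0 : 'cV[R]_n)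
    (k : nat) : 'cV[R]_n :=
  if k is k'.+1 then step (tau k') (iterates step tau x0 k') else x0.

(* Main.v *)
Require Import Defs.
From HB Require Import structures.
From mathcomp Require Import all_boot all_order all_algebra.
From mathcomp Require Import all_classical all_reals all_analysis.
Import Order.TTheory GRing.Theory Num.Theory.
Import numFieldNormedType.Exports.

(** At a point x of each of the three manifolds the linear map [sharp x] turns a
covector w, i.e. the Euclidean representative of a differential, into the
tangent vector that represents it for the Fisher-Rao metric ([metric_sharp]).
The metric is definite, so such a representative is unique, and the Riemannian
gradient is [sharp x] applied to the Euclidean gradient ([rgradE]).  By
definition exp_x is Exp_x composed with [sharp x]; hence the two forms of
Riemannian gradient descent agree.

For the SMART iteration, a single computation covers the three geometries:
[sharp x] multiplies w - c componentwise by the inverse metric weights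
[Gdiag x], where c is 0 for the orthant and the box, and the x-average
[mean x w] for the simplex ([sharpE]).  The quotients inside Exp_x cancel these
weights, which leaves the exponentials of w - c.  The scalar c, which comes from
the projection to the tangent space of the simplex, contributes a common factor
exp(-c) that the normalization of Exp_x removes; what remains is the SMART
update ([smart_stepE]).  Since Exp_x takes its values in the manifold
([Exp_carrier]), the argument applies at every iterate, and the iterations
coincide by induction.

For KL(Ax, b), a row of the nonnegative matrix A is either zero, and
contributes a constant, or gives a linear form that is positive on the whole
open orthant ([row_mul_eq0_or_gt0]), where s (ln s - ln b_j) - (s - b_j) is
smooth with derivative ln s - ln b_j.  So the open orthant, which contains all
three manifolds, is a neighbourhood on which KL(Ax, b) is continuously
differentiable, with gradient A^T (ln(Ax) - ln b). *)

Set Implicit Arguments.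
Unset Strict Implicit.
Unset Printing Implicit Defensive.

Local Open Scope classical_set_scope.
Local Open Scope ring_scope.

(** * Diagonal matrices acting on column vectors *)

Section DiagonalMatrices.
Variables (R : realType) (n : nat).
Implicit Types (v d : 'cV[R]_n).

Lemma mul_Diag d v : Diag d *m v = d ⊙ v.
Proof.
by apply/matrixP => i j; rewrite mul_diag_mx !mxE (ord1 j).
Qed.

Lemma inv_Diag d : (forall i, d i 0 != 0) -> invmx (Diag d) = Diag (ones ⊘ d).
Proof.
move=> d0.
have dK : Diag d *m Diag (ones ⊘ d) = 1%:M.
  rewrite mulmx_diag -diag_const_mx; congr diag_mx.
  by apply/rowP => i; rewrite !mxE mul1r mulfV.
have [du _] := mulmx1_unit dK.
by rewrite -[RHS](mulKmx du) dK mulmx1.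
Qed.

End DiagonalMatrices.

(** * Fisher-Rao metric and Riemannian gradient *)

Section FisherRaoGradient.
Variables (R : realType) (n : nat) (M : geometry).
Implicit Types (x u v w : 'cV[R]_n) (f : 'cV[R]_n -> R).

(** The diagonal of the inverse metric matrix, in a form without division. *)
Definition Gdiag x : 'cV[R]_n :=
  match M with Box => x ⊙ (ones - x) | _ => x end.

Lemma G_E x : G M x = Diag (ones ⊘ Gdiag x).
Proof. by rewrite /G /Gdiag; case: M. Qed.

Lemma Gdiag_gt0 x i : carrier M x -> 0 < Gdiag x i 0.
Proof.
rewrite /carrier /Gdiag; case: M => /= [|xM|[]] //.
by case/andP: (xM i) => x0 x1; rewrite !mxE mulr_gt0 // subr_gt0.
Qed.

Lemma metricE x u v : metric M x u v = \sum_i u i 0 * v i 0 / Gdiag x i 0.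
Proof.
rewrite /metric /inner G_E mul_Diag; apply: eq_bigr => i _.
by rewrite !mxE mul1r [_^-1 * _]mulrC mulrA.
Qed.

Lemma metric_definite x v : carrier M x -> metric M x v v = 0 -> v = 0.
Proof.
move=> xM; rewrite metricE => /psumr_eq0P v0; apply/colP => i; rewrite !mxE.
have t0 j : true -> 0 <= v j 0 * v j 0 / Gdiag x j 0.
  by move=> _; rewrite divr_ge0 ?sqr_ge0// ltW // Gdiag_gt0.
have /eqP := v0 t0 i isT.
rewrite mulf_eq0 invr_eq0 (gt_eqF (Gdiag_gt0 _ xM)) orbF mulf_eq0 orbb.
by move/eqP.
Qed.

(** On the simplex the metric matrix does not map the tangent space into itself;
its inverse is replaced by the projected version Diag(x) - x x^T, which takes
values in the tangent space. *)
Definition sharp x : 'M[R]_n :=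
  match M with
  | Orthant | Box => invmx (G M x)
  | Simplex => Diag x - x *m x^T
  end.

Lemma exp_mapE x w : exp_map M x w = Exp M x (sharp x *m w).
Proof. by rewrite /exp_map /sharp; case: M. Qed.

(** The constant that has to be subtracted from all entries of w before
weighting by [Gdiag x], so that the result is tangent. *)
Definition mean x w : R := match M with Simplex => ⟨x, w⟩ | _ => 0 end.

(** This puts the three geometries in a common form, on which all later
computations with [sharp] rely. *)
Lemma sharpE x w i : carrier M x ->
  (sharp x *m w) i 0 = Gdiag x i 0 * (w i 0 - mean x w).
Proof.
move=> xM; rewrite /sharp; case EM : M; rewrite /mean EM.
1,2: rewrite -EM G_E inv_Diag ?mul_Diag.
1,3: by rewrite !mxE !mul1r invrK subr0.
1,2: by move=> j; rewrite !mxE mul1r invr_eq0 gt_eqF// Gdiag_gt0.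
rewrite mulmxBl mul_Diag -mulmxA !mxE big_ord1 mulrBr /Gdiag EM.
congr (_ - _ * _).
by rewrite !mxE; apply: eq_bigr => j _; rewrite !mxE.
Qed.

(** Either the correction vanishes or the tangent vectors have zero sum; this is
why subtracting it does not change the pairing with tangent vectors. *)
Lemma mean_tangent x w v : tangent M v -> mean x w * ⟨ones, v⟩ = 0.
Proof.
by rewrite /tangent /mean; case: M => /=; rewrite ?mul0r// => ->; rewrite mulr0.
Qed.

Lemma sharp_tangent x w : carrier M x -> tangent M (sharp x *m w).
Proof.
move=> xM; rewrite /tangent; case EM : M => //=.
rewrite /inner; under eq_bigr do rewrite mxE mul1r sharpE// mulrBr.
have [_ x1] : carrier Simplex x by rewrite -EM.
rewrite sumrB -mulr_suml /Gdiag /mean EM.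
move: x1; rewrite /inner; under eq_bigr do rewrite mxE mul1r.
by move=> ->; rewrite mul1r subrr.
Qed.

(** The weights [Gdiag x] cancel against those of the metric, and the correction
[mean x w] is invisible to tangent vectors. *)
Lemma metric_sharp x w v : carrier M x -> tangent M v ->
  metric M x (sharp x *m w) v = ⟨w, v⟩.
Proof.
move=> xM vM; rewrite metricE.
transitivity (\sum_i (w i 0 * v i 0 - mean x w * v i 0)).
  apply: eq_bigr => i _; rewrite sharpE// -mulrBl -!mulrA mulrC -!mulrA.
  by rewrite mulVf ?mulr1// gt_eqF// Gdiag_gt0.
rewrite sumrB -mulr_sumr; have := mean_tangent x w vM.
by rewrite /inner; under eq_bigr do rewrite mxE mul1r; move=> ->; rewrite subr0.
Qed.

Lemma diff_egrad f x v : differentiable f x -> 'd f x v = ⟨egrad f x, v⟩.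
Proof.
move=> df.
rewrite {1}(_ : v = \sum_i v i 0 *: (delta_mx i 0 : 'cV[R]_n)); last first.
  by rewrite {1}(matrix_sum_delta v); apply: eq_bigr => i _; rewrite big_ord1.
rewrite linear_sum; apply: eq_bigr => i _.
by rewrite linearZ mxE deriveE// mulrC.
Qed.

Lemma sharp_rgrad f x : carrier M x -> differentiable f x ->
  is_rgrad M f x (sharp x *m egrad f x).
Proof.
move=> xM df; split=> [|v vM]; first exact: sharp_tangent.
by rewrite metric_sharp// diff_egrad.
Qed.

(** The difference of two Riemannian gradients is tangent and orthogonal to
every tangent vector, in particular to itself. *)
Lemma is_rgrad_inj f x u v : carrier M x ->
  is_rgrad M f x u -> is_rgrad M f x v -> u = v.
Proof.
move=> xM [uM ud] [vM vd]; apply/subr0_eq/(@metric_definite x) => //.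
have uvM : tangent M (u - v).
  move: uM vM; rewrite /tangent; case: M => //=.
  rewrite /inner => u0 v0; transitivity (⟨ones, u⟩ - ⟨ones, v⟩).
    by rewrite -sumrB; apply: eq_bigr => i _; rewrite !mxE mulrBr.
  by rewrite /inner u0 v0 subrr.
have : metric M x u (u - v) - metric M x v (u - v) = 0.
  by rewrite ud// vd// subrr.
rewrite !metricE -sumrB => uv0; rewrite -[RHS]uv0; apply: eq_bigr => i _.
by rewrite !mxE -!mulrBl.
Qed.

Lemma rgradE f x : carrier M x -> differentiable f x ->
  rgrad M f x = sharp x *m egrad f x.
Proof.
move=> xM df; apply: xget_unique; first exact: sharp_rgrad.
by move=> u ru; apply: (is_rgrad_inj xM ru); exact: sharp_rgrad.
Qed.

End FisherRaoGradient.

(** * One step of the iterations *)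

Section Steps.
Variables (R : realType) (n : nat) (M : geometry).
Implicit Types (x v w : 'cV[R]_n) (f : 'cV[R]_n -> R) (t : R).

(** The sum cannot vanish, because then x would be zero, contrary to its entries
adding up to 1. *)
Lemma simplex_dot_gt0 x v : carrier Simplex x -> 0 < ⟨x, vexp v⟩.
Proof.
move=> [x0 x1].
have t0 i : true -> 0 <= x i 0 * vexp v i 0.
  by move=> _; rewrite mxE mulr_ge0 ?expR_ge0// ltW.
rewrite lt0r sumr_ge0// andbT; apply/negP => /eqP/psumr_eq0P => /(_ t0) s0.
move: x1; rewrite /inner big1 => [/eqP|i _]; first by rewrite eq_sym oner_eq0.
have /eqP := s0 i isT.
by rewrite !mxE mulf_eq0 (gt_eqF (expR_gt0 _)) orbF => /eqP ->; rewrite mulr0.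
Qed.

Lemma Exp_carrier x v : carrier M x -> carrier M (Exp M x v).
Proof.
rewrite /Exp; case: M => [xM i|xM i|xM].
- by rewrite !mxE mulr_gt0 ?expR_gt0.
- have /andP[x0 x1] := xM i; rewrite !mxE.
  set y := x i 0 * _; have y0 : 0 < y by rewrite mulr_gt0 ?expR_gt0.
  have x1' : 0 < 1 - x i 0 by rewrite subr_gt0.
  have d0 : 0 < 1 - x i 0 + y by rewrite addr_gt0.
  by rewrite divr_gt0//= ltr_pdivrMr// mul1r ltrDr.
- have s0 := simplex_dot_gt0 (v ⊘ x) xM; case: xM => xM _; split=> [i|].
    by rewrite !mxE !mulr_gt0 ?expR_gt0// invr_gt0.
  rewrite /inner; under eq_bigr do rewrite !mxE mul1r.
  rewrite -mulr_sumr.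
  rewrite [X in _ * X](_ : _ = ⟨x, vexp (v ⊘ x)⟩) ?mulVf ?gt_eqF//.
  by apply: eq_bigr => i _; rewrite !mxE.
Qed.

(** The weights introduced by [sharp] are those by which Exp divides, and the
common factor exp(- mean x w) disappears in the normalization. *)
Lemma smart_stepE f t x : carrier M x ->
  smart_step M f t x = Exp M x (sharp M x *m (- t *: egrad f x)).
Proof.
rewrite /smart_step /Z; move: (_ *: _) => w xM; apply/esym.
have e i : expR ((sharp M x *m w) i 0 / Gdiag M x i 0) =
    (expR (mean M x w))^-1 * expR (w i 0).
  rewrite sharpE// [_ * (_ - _)]mulrC mulfK ?gt_eqF ?Gdiag_gt0//.
  by rewrite expRD expRN mulrC.
move: (sharp M x *m w) e => u e.
rewrite /Exp; case EM : M; apply/colP => i.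
- move: (e i); rewrite /mean /Gdiag EM expR0 invr1 mul1r !mxE => ->.
  by rewrite divr1 mul1r.
- move: (e i); rewrite /mean /Gdiag EM expR0 invr1 mul1r !mxE => ->.
  by rewrite mul1r -[RHS]mulrA [RHS]mulrC.
- have e' j : x j 0 * vexp (u ⊘ x) j 0 =
      (expR (mean M x w))^-1 * (x j 0 * vexp w j 0).
    by rewrite mulrCA [vexp w j 0]mxE -e /Gdiag EM !mxE.
  rewrite mxE [(x ⊙ _) i 0]mxE e' /inner.
  under eq_bigr do rewrite e'.
  rewrite -mulr_sumr invfM mulrACA invrK divff ?gt_eqF ?expR_gt0//.
  by rewrite !mxE !mul1r mulrA.
Qed.

Lemma rgd_stepE f t x : carrier M x -> differentiable f x ->
  rgd_step M f t x = smart_step M f t x.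
Proof. by move=> xM df; rewrite smart_stepE// /rgd_step rgradE// scalemxAr. Qed.

Lemma exp_stepE f t x : carrier M x -> exp_step M f t x = smart_step M f t x.
Proof. by move=> xM; rewrite smart_stepE// /exp_step exp_mapE. Qed.

End Steps.

(** * Smoothness of the Kullback-Leibler objective *)

Section KullbackLeibler.
Variable R : realType.

Lemma open_orthant n : open (carrier Orthant : set 'cV[R]_n).
Proof.
rewrite openE => x x0; exists (fun i j => [set r : R | 0 < r]).
  by move=> i j; rewrite (ord1 j); exact: lt_nbhsr.
by move=> y y0 i; exact: y0.
Qed.

Lemma is_diff_sum (V W : normedModType R) m (f df : 'I_m -> V -> W) (x : V) :
  (forall j, is_diff x (f j) (df j)) ->
  is_diff x (\sum_j f j) (\sum_j df j).
Proof.
move=> fdf; elim/big_ind2: _ => [|g dg h dh gdg hdh|j _]; last exact: fdf.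
  exact: is_diff_cst.
exact: is_diffD.
Qed.

(** The entry is a linear form, hence its own differential once it is
continuous; continuity comes from writing it as a finite combination of
coordinates. *)
Lemma is_diff_mulmx_entry m n (A : 'M[R]_(m, n)) j (x : 'cV[R]_n) :
  is_diff x (fun y : 'cV[R]_n => (A *m y) j 0) (fun v => (A *m v) j 0).
Proof.
pose row_form (y : 'cV[R]_n) := (A *m y) j 0.
have row_form_linear : linear row_form.
  by move=> a u v; rewrite /row_form linearP !mxE.
pose l : {linear 'cV[R]_n -> R} :=
  HB.pack row_form (GRing.isLinear.Build _ _ _ _ _ row_form_linear).
have lE : l = \sum_k (A j k *: (fun y : 'cV[R]_n => y k 0)) :> (_ -> _).
  by apply/funext => y; rewrite fct_sumE [LHS]mxE.
have dl (y : 'cV[R]_n) : differentiable l y.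
  rewrite lE; apply: differentiable_sum => k.
  by apply: differentiableZ; exact: differentiable_coord.
apply: DiffDef; first exact: dl.
by apply: (diff_lin (f := l)) => y; exact: differentiable_continuous.
Qed.

Lemma is_derive_KLterm (c d s : R) : 0 < s ->
  is_derive s 1 (fun s => s * (ln s - c) - (s - d)) (ln s - c).
Proof.
move=> s0; have := is_derive1_ln s0 => ds.
apply: is_derive_eq.
rewrite !subr0 /GRing.scale /= mulr1 mulfV ?gt_eqF//.
by rewrite addrAC subrr add0r.
Qed.

(** This dichotomy keeps the logarithms in KL(Ax, b) away from their singularity
at 0: the vanishing entries of Ax vanish identically. *)
Lemma row_mul_eq0_or_gt0 m n (A : 'M[R]_(m, n)) j :
  (forall i j, 0 <= A i j) ->
  row j A = 0 \/ forall x : 'cV[R]_n, carrier Orthant x -> 0 < (A *m x) j 0.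
Proof.
move=> A0; have [->|rA] := eqVneq (row j A) 0; [by left|right => x x0].
have t0 k : true -> 0 <= A j k * x k 0 by rewrite mulr_ge0// ltW.
rewrite mxE lt0r sumr_ge0// andbT; apply: contra_neqN rA => /eqP/psumr_eq0P s0.
apply/rowP => k; rewrite !mxE; have /eqP := s0 t0 k isT.
by rewrite mulf_eq0 (gt_eqF (x0 k)) orbF => /eqP.
Qed.

(** Each summand is a function of the single number s = (Ax)_j; differentiating
s ln s - s leaves only ln s, since the constants 1 and -1 cancel, so the
logarithms alone appear in the differential. *)
Lemma is_diff_KL m n (A : 'M[R]_(m, n)) (b : 'cV[R]_m) (x : 'cV[R]_n) :
  (forall i j, 0 <= A i j) -> carrier Orthant x ->
  is_diff x (fun y : 'cV[R]_n => KL (A *m y) b)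
    (fun v => ⟨A *m v, vln (A *m x) - vln b⟩).
Proof.
move=> A0 x0.
pose f j (y : 'cV[R]_n) : R :=
  (A *m y) j 0 * (ln ((A *m y) j 0) - ln (b j 0)) - ((A *m y) j 0 - b j 0).
pose df j (v : 'cV[R]_n) : R := (A *m v) j 0 * (ln ((A *m x) j 0) - ln (b j 0)).
have -> : (fun y => KL (A *m y) b) = \sum_j f j.
  apply/funext => y; rewrite /KL /inner -sumrB fct_sumE; apply: eq_bigr => j _.
  by rewrite /f [ones _ _]mxE mul1r [(vln _ - _) _ _]mxE [(- vln _) _ _]mxE
    [(_ - b) _ _]mxE [(- b) _ _]mxE ![vln _ _ _]mxE.
have -> : (fun v => ⟨A *m v, vln (A *m x) - vln b⟩) = \sum_j df j.
  apply/funext => y; rewrite /inner fct_sumE; apply: eq_bigr => j _.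
  by rewrite /df [(vln _ - _) _ _]mxE [(- vln _) _ _]mxE ![vln _ _ _]mxE.
apply: is_diff_sum => j.
have [rA|lgt0] := row_mul_eq0_or_gt0 j A0.
  (* A zero row contributes the constant b_j, whatever the value of ln 0. *)
  have l0 (y : 'cV[R]_n) : (A *m y) j 0 = 0.
    have : row j (A *m y) = 0 by rewrite row_mul rA mul0mx.
    by move/rowP/(_ 0); rewrite !mxE.
  have -> : f j = cst (b j 0).
    by apply/funext => y; rewrite /f l0 mul0r !sub0r opprK.
  have -> : df j = 0 by apply/funext => y; rewrite /df l0 mul0r.
  exact: is_diff_cst.
pose phi (s : R) := s * (ln s - ln (b j 0)) - (s - b j 0).
have s0 := lgt0 _ x0.
have [phid phi'] := is_derive_KLterm (ln (b j 0)) (b j 0) s0.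
have phi_diff : is_diff ((A *m x) j 0) phi
    ( *:%R^~ (ln ((A *m x) j 0) - ln (b j 0))).
  have dphi : differentiable phi ((A *m x) j 0) by apply/derivable1_diffP.
  by apply: DiffDef => //; rewrite diff1E// derive1E phi'.
exact: (is_diff_comp (is_diff_mulmx_entry A j x) phi_diff).
Qed.

Lemma egrad_KL m n (A : 'M[R]_(m, n)) (b : 'cV[R]_m) (x : 'cV[R]_n) :
  (forall i j, 0 <= A i j) -> carrier Orthant x ->
  egrad (fun y : 'cV[R]_n => KL (A *m y) b) x = A^T *m (vln (A *m x) - vln b).
Proof.
move=> A0 x0; have [df dE] := is_diff_KL b A0 x0.
apply/colP => i; rewrite !mxE deriveE// dE /inner; apply: eq_bigr => j _.
by rewrite -colE [A^T _ _]mxE [col _ _ _ _]mxE.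
Qed.

(** The gradient formula exhibits the gradient near x as a finite sum of
differentiable functions, which gives its continuity. *)
Lemma C1_KL n M m (A : 'M[R]_(m, n)) (b : 'cV[R]_m) :
  (forall i j, 0 <= A i j) ->
  C1_around (carrier M) (fun x : 'cV[R]_n => KL (A *m x) b).
Proof.
move=> A0; exists (carrier Orthant); split.
- exact: open_orthant.
- by case: M => // x; [move=> x01 i; case/andP: (x01 i)|case].
- by move=> x x0; have [] := is_diff_KL b A0 x0.
move=> x x0.
pose g (y : 'cV[R]_n) := \sum_j (ln ((A *m y) j 0) - ln (b j 0)) *: (row j A)^T.
have gE y : carrier Orthant y -> g y = egrad (fun y => KL (A *m y) b) y.
  move=> y0; rewrite egrad_KL//; apply/colP => i.
  rewrite /g summxE [RHS]mxE; apply: eq_bigr => j _.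
  rewrite mulrC [LHS]mxE [(row _ _)^T _ _]mxE [row _ _ _ _]mxE [A^T _ _]mxE.
  by rewrite [(vln _ - _) _ _]mxE [(- vln _) _ _]mxE ![vln _ _ _]mxE.
have gd : differentiable g x.
  rewrite (_ : g = \sum_j (fun y : 'cV[R]_n =>
      (ln ((A *m y) j 0) - ln (b j 0)) *: (row j A)^T)); last first.
    by apply/funext => y; rewrite fct_sumE.
  apply: differentiable_sum => j.
  have [->|lgt0] := row_mul_eq0_or_gt0 j A0.
    by under eq_fun do rewrite trmx0 scaler0; exact: differentiable_cst.
  apply/differentiableZl/differentiableB; last exact: differentiable_cst.
  have [lx _] := is_diff_mulmx_entry A j x.
  apply: (differentiable_comp lx); apply/derivable1_diffP.
  by have [] := is_derive1_ln (lgt0 _ x0).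
have gc : {for x, continuous g} := differentiable_continuous gd.
have gE_near : {near x, g =1 egrad (fun y => KL (A *m y) b)}.
  near=> y; apply: gE; near: y.
  by apply: open_nbhs_nbhs; split=> //; exact: open_orthant.
rewrite /prop_for /continuous_at -(gE x x0).
exact: cvg_trans (near_eq_cvg gE_near) gc.
Unshelve. all: by end_near. Qed.

End KullbackLeibler.

(** * Equality of the iterations *)

Theorem corollary4p7 (R : realType) (n : nat) (M : geometry) :
  (forall (f : 'cV[R]_n -> R) (tau : nat -> R) (x0 : 'cV[R]_n),
     C1_around (carrier M) f -> (forall k, 0 < tau k) -> carrier M x0 ->
     let x := iterates (smart_step M f) tau x0 in
     [/\ forall k, carrier M (x k) /\ exists! u, is_rgrad M f (x k) u,
         forall k, x k.+1 = Exp M (x k) (- tau k *: rgrad M f (x k)) /\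
                   x k.+1 = exp_map M (x k) (- tau k *: egrad f (x k)),
         x = iterates (rgd_step M f) tau x0 &
         x = iterates (exp_step M f) tau x0]) /\
  (forall (m : nat) (A : 'M[R]_(m, n)) (b : 'cV[R]_m),
     (forall i j, 0 <= A i j) -> (forall i, 0 < b i 0) ->
     C1_around (carrier M) (fun x : 'cV[R]_n => KL (A *m x) b)).
Proof.
split=> [f tau x0 [U [_ MU Udf _]] _ x0M x|m A b A0 _]; last exact: C1_KL.
have df y : carrier M y -> differentiable f y by move=> /MU; exact: Udf.
have xM k : carrier M (x k).
  by elim: k => [//|k IH]; rewrite /x /= smart_stepE//; exact: Exp_carrier.
split.
- move=> k; split=> //; exists (sharp M (x k) *m egrad f (x k)).
  have grad_xk := sharp_rgrad (xM k) (df _ (xM k)).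
  by split=> // u; exact: (is_rgrad_inj (xM k)).
- move=> k; split.
    by rewrite -[RHS]/(rgd_step M f (tau k) (x k)) rgd_stepE//; exact: df.
  by rewrite -[RHS]/(exp_step M f (tau k) (x k)) exp_stepE.
- apply/funext; elim=> [//|k IH].
  by rewrite [RHS]/= -IH rgd_stepE//; exact: df.
- by apply/funext; elim=> [//|k IH]; rewrite [RHS]/= -IH exp_stepE.
Qed.
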